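(* Let $f\in C^4(\Omega;\mathbb{R}^n)$, with $0\in\Omega\subseteq\mathbb{R}^n$ open, be such that the system $\partial_t u+\partial_x f(u)=0$ is strictly hyperbolic and each characteristic field is either genuinely nonlinear or linearly degenerate. There exist positive constants $C_0,\delta_o$ (depending only on $f$ and on the chosen parametrization of the wave curves) such that for every $\delta\in\,]0,\delta_o[$ the functionals $\bar{\mathbf Q}$ and $\bar{\mathbf\Upsilon}$, defined on $\mathcal D_\delta$ by $$\bar{\mathbf Q}(u)=\lim_{\eta\to0+}\inf_{v\in B_\eta(u)}\mathbf Q(v),\qquad \bar{\mathbf\Upsilon}(u)=\lim_{\eta\to0+}\inf_{v\in B_\eta(u)}\mathbf\Upsilon(v),$$ are lower semicontinuous with respect to the $L^1$ norm.
   Context: **Wave curves.** $\lambda_1(u)<\dots<\lambda_n(u)$ are the eigenvalues of $Df(u)$, $r_j(u)$ the right eigenvectors. $\sigma\mapsto R_j(\sigma)(u)$ is the $j$-th rarefaction curve through $u$: $\partial_\sigma R_j(\sigma)(u)=r_j(R_j(\sigma)(u))$, $R_j(0)(u)=u$. $\sigma\mapsto S_j(\sigma)(u)$ is the $j$-th shock (Rankine–Hugoniot) curve through $u$: the curve of states $w$ near $u$ with $f(w)-f(u)=s\,(w-u)$ for some $s$ near $\lambda_j(u)$, tangent to $r_j(u)$ at $u=S_j(0)(u)$. If the $j$-th field is linearly degenerate, $\sigma$ is arc-length; if it is genuinely nonlinear, $\sigma$ (and $r_j$) are chosen so that $\partial_\sigma\lambda_j(R_j(\sigma)(u))=k_j$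 and $\partial_\sigma\lambda_j(S_j(\sigma)(u))=k_j$, with arbitrary fixed $k_j>0$. The Lax curve is $\psi_j(\sigma)(u)=R_j(\sigma)(u)$ for $\sigma\ge0$ and $S_j(\sigma)(u)$ for $\sigma<0$. For $u^-,u^+$ close to $0$, $E(u^-,u^+)=(\sigma_1,\dots,\sigma_n)$ is the unique small vector with $u^+=\psi_n(\sigma_n)\circ\dots\circ\psi_1(\sigma_1)(u^-)$. $\Omega$ is understood to be shrunk to a small neighbourhood of $0$ on which $E$ is defined. **Glimm functionals and domains.** Piecewise constant functions have finitely many jumps; $\mathcal I(u)$ is the jump set; right continuous representatives are used. For $u$ piecewise constant put $(\sigma_{x,1},\dots,\sigma_{x,n})=E(u(x-),u(x+))$. $\mathcal A(u)$ is the set of pairs $((x,i),(y,j))\in(\mathcal I(u)\times\{1,\dots,n\})^2$ with $x<y$ and either $i>j$, or $i=j$, the $i$-th field genuinely nonlinear and $\min\{\sigma_{x,i},\sigma_{y,j}\}<0$. Set $$\mathbf V(u)=\sum_{x\in\mathcal I(u)}\sum_{i=1}^n|\sigma_{x,i}|,\quad \mathbf Q(u)=\sum_{((x,i),(y,j))\in\mathcal A(u)}|\sigma_{x,i}\sigma_{y,j}|,\quad \mathbf\Upsilon(u)=\mathbf V(u)+C_0\mathbf Q(u).$$ $\mathcal D^*_\delta=\{v\in L^1(\mathbb R;\Omega): v\text{ piecewise constant},\ \mathbf\Upsilon(v)<\delta\}$, and $\mathcal D_\delta$ is its closure in $L^1$. For $u\in\mathcal D_\delta$, $\eta>0$: $B_\eta(u)=\{v\in\mathcal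 D^*_\delta:\|v-u\|_{L^1}<\eta\}$. *)

(* Defs.v *)
From HB Require Import structures.
From mathcomp Require Import all_boot all_order all_algebra.
From mathcomp Require Import all_classical all_reals all_analysis.

Set Implicit Arguments.
Unset Strict Implicit.
Unset Printing Implicit Defensive.

Import Order.TTheory GRing.Theory Num.Theory.
Import numFieldNormedType.Exports.

Local Open Scope classical_set_scope.
Local Open Scope ring_scope.

(* The library norm on ['rV[R]_n] is the sup norm; arc length and the [L^1]
   norm use the Euclidean one. *)
Definition enorm (R : realType) (n : nat) (v : 'rV[R]_n) : R :=
  Num.sqrt (\sum_(i < n) (v ord0 i) ^+ 2).

(* Functions are total; since [Om] is open, only the values of [f] on [Om]
   matter. *)
Fixpoint Ck_on (R : realType) (n m : nat) (k : nat) (Om : set 'rV[R]_n)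
    (f : 'rV[R]_n -> 'rV[R]_m) : Prop :=
  match k with
  | 0 => forall u, Om u -> {for u, continuous f}
  | k'.+1 => (forall u, Om u -> differentiable f u) /\
             (forall v : 'rV[R]_n, Ck_on k' Om (fun u => 'D_v f u))
  end.

Section WaveCurves.
Variables (R : realType) (n : nat).
Local Notation state := 'rV[R]_n.

(* [rar w j sigma u] and [sho w j sigma u] are $R_j(\sigma)(u)$ and
   $S_j(\sigma)(u)$; they are meaningful for [base w u] and
   [`|sigma| < radius w]. *)
Record wave_param := WaveParam {
  lambda : 'I_n -> state -> R;
  rvec : 'I_n -> state -> state;
  kappa : 'I_n -> R;
  rar : 'I_n -> R -> state -> state;
  sho : 'I_n -> R -> state -> state;
  base : set state;
  radius : R }.

Variables (f : state -> state) (Om : set state).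

(* States are row vectors, so that ['J f u] is the transpose of $Df(u)$ and the
   right eigenvectors of $Df(u)$ are the row eigenvectors of ['J f u]. *)
Definition ordered_eigenvalues (u : state) (l : 'I_n -> R) :=
  (forall i j : 'I_n, (i < j)%N -> l i < l j) /\
  (forall i, eigenvalue ('J f u) (l i)).

Definition strictly_hyperbolic :=
  forall u, Om u -> exists l : 'I_n -> R, ordered_eigenvalues u l.

Variable w : wave_param.

Definition right_eigenvectors :=
  forall j u, Om u ->
    rvec w j u != 0 /\ rvec w j u *m 'J f u = lambda w j u *: rvec w j u.

Definition genuinely_nonlinear (j : 'I_n) :=
  forall u, Om u -> 'D_(rvec w j u) (lambda w j) u != 0.

Definition linearly_degenerate (j : 'I_n) :=
  forall u, Om u -> 'D_(rvec w j u) (lambda w j) u = 0.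

Definition well_parametrized (j : 'I_n) (c : R -> state) :=
  forall sigma : R, `|sigma| < radius w ->
    [/\ derivable c sigma 1,
        genuinely_nonlinear j ->
          is_derive sigma (1 : R) (fun s => lambda w j (c s)) (kappa w j) &
        linearly_degenerate j -> enorm ('D_1 c sigma) = 1].

Definition rarefaction_curve (j : 'I_n) (u : state) :=
  [/\ rar w j 0 u = u,
      forall sigma, `|sigma| < radius w -> Om (rar w j sigma u),
      forall sigma : R, `|sigma| < radius w ->
        is_derive sigma (1 : R) (fun s => rar w j s u)
          (rvec w j (rar w j sigma u)) &
      well_parametrized j (fun s => rar w j s u)].

Definition rankine_hugoniot (u v : state) (s : R) := f v - f u = s *: (v - u).

(* The two last clauses say that the curve lies in the Hugoniot locus of [u],
   with a speed issuing continuously from $\lambda_j(u)$, and that close to [u]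
   it exhausts the part of this locus with speed close to $\lambda_j(u)$. *)
Definition shock_curve (j : 'I_n) (u : state) :=
  [/\ sho w j 0 u = u /\
        is_derive (0 : R) (1 : R) (fun s => sho w j s u) (rvec w j u),
      forall sigma, `|sigma| < radius w -> Om (sho w j sigma u),
      well_parametrized j (fun s => sho w j s u),
      exists2 s : R -> R, s 0 = lambda w j u &
        forall sigma, `|sigma| < radius w ->
          {for sigma, continuous s} /\
          rankine_hugoniot u (sho w j sigma u) (s sigma) &
      exists2 e : R, 0 < e &
        forall (v : state) (s : R), Om v ->
          enorm (v - u) < e -> `|s - lambda w j u| < e ->
          rankine_hugoniot u v s ->
          exists2 sigma, `|sigma| < radius w & v = sho w j sigma u].

(* [rvec] is continuous on [base] only: on an [Om] which is not simply connected
   a continuous choice of unit eigenvectors may fail to exist. *)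
Definition wave_curves :=
  [/\ [/\ open (base w), base w 0, base w `<=` Om & 0 < radius w],
      forall u, Om u -> ordered_eigenvalues u (fun j => lambda w j u),
      forall j, 0 < kappa w j,
      right_eigenvectors &
      forall j u, base w u ->
        [/\ {for u, continuous (rvec w j)}, rarefaction_curve j u &
            shock_curve j u]].

Definition lax (j : 'I_n) (sigma : R) (u : state) : state :=
  if 0 <= sigma then rar w j sigma u else sho w j sigma u.

(* The state reached from [u] after crossing the waves of the first [m]
   families; for [m = n] this is
   $\psi_n(\sigma_n)\circ\dots\circ\psi_1(\sigma_1)(u)$. *)
Definition lax_state (sigma : 'rV[R]_n) (u : state) (m : nat) : state :=
  foldl (fun v j => lax j (sigma ord0 j) v) u (take m (enum 'I_n)).

Definition solves_riemann (um up : state) (sigma : 'rV[R]_n) :=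
  [/\ forall j, `|sigma ord0 j| < radius w,
      forall m, (m < n)%N -> base w (lax_state sigma um m) &
      lax_state sigma um n = up].

Definition E (um up : state) : 'rV[R]_n := get (solves_riemann um up).

Definition E_defined_on (Om0 : set state) :=
  forall um up, Om0 um -> Om0 up -> exists! sigma, solves_riemann um up sigma.

Definition left_lim (u : R -> state) (x : R) : state := lim (u @ x^'-).
Definition right_lim (u : R -> state) (x : R) : state := lim (u @ x^'+).

Definition jumps (u : R -> state) : set R :=
  [set x | left_lim u x <> right_lim u x].

(* [u] is constant on the half-open intervals [[a, b[] cut out by the points of
   [s]: the right continuous representative of a step function. *)
Definition piecewise_constant (u : R -> state) :=
  exists s : seq R, forall x y : R, x <= y ->
    (forall a, a \in s -> ~~ (x < a <= y)) -> u x = u y.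

Definition strength (u : R -> state) (p : R * 'I_n) : R :=
  E (left_lim u p.1) (right_lim u p.1) ord0 p.2.

Definition approaching (u : R -> state) : set ((R * 'I_n) * (R * 'I_n)) :=
  [set p : (R * 'I_n) * (R * 'I_n) |
      [/\ jumps u p.1.1, jumps u p.2.1, p.1.1 < p.2.1 &
       (p.2.2 < p.1.2)%N \/
       [/\ p.1.2 = p.2.2, genuinely_nonlinear p.1.2 &
           Num.min (strength u p.1) (strength u p.2) < 0]]].

Definition V (u : R -> state) : R :=
  \sum_(x \in jumps u) \sum_(i < n) `|strength u (x, i)|.

Definition Q (u : R -> state) : R :=
  \sum_(p \in approaching u) `|strength u p.1 * strength u p.2|.

Definition Upsilon (C0 : R) (u : R -> state) : R := V u + C0 * Q u.

(* Elements of $L^1$ are represented by functions; the seminorm below does not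
   separate functions which agree almost everywhere. *)
Definition L1 (u : R -> state) :=
  forall i, (@lebesgue_measure R).-integrable setT (fun x => (u x ord0 i)%:E).

Definition L1dist (u v : R -> state) : \bar R :=
  (\int[@lebesgue_measure R]_x (enorm (u x - v x))%:E)%E.

Definition Dstar (Om0 : set state) (C0 delta : R) : set (R -> state) :=
  [set v | [/\ L1 v, forall x, Om0 (v x), piecewise_constant v &
               Upsilon C0 v < delta]].

Definition D (Om0 : set state) (C0 delta : R) : set (R -> state) :=
  [set u | L1 u /\ forall eta : R, 0 < eta ->
     exists2 v, Dstar Om0 C0 delta v & (L1dist v u < eta%:E)%E].

Definition B (Om0 : set state) (C0 delta : R) (eta : R) (u : R -> state) :
    set (R -> state) :=
  [set v | Dstar Om0 C0 delta v /\ (L1dist v u < eta%:E)%E].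

Definition inf_near (Om0 : set state) (C0 delta : R) (F : (R -> state) -> R)
    (u : R -> state) (eta : R) : \bar R :=
  ereal_inf [set (F v)%:E | v in B Om0 C0 delta eta u].

Definition relaxed (Om0 : set state) (C0 delta : R) (F : (R -> state) -> R)
    (u : R -> state) : \bar R :=
  lim (inf_near Om0 C0 delta F u eta @[eta --> 0^'+]).

Definition Qbar (Om0 : set state) (C0 delta : R) :=
  relaxed Om0 C0 delta Q.

Definition Upsilonbar (Om0 : set state) (C0 delta : R) :=
  relaxed Om0 C0 delta (Upsilon C0).

(* The limit defining [relaxed F u] exists and is a real number, so that
   [relaxed F] is a genuine functional on [D]. *)
Definition well_defined (Om0 : set state) (C0 delta : R)
    (F : (R -> state) -> R) :=
  forall u, D Om0 C0 delta u ->
    (inf_near Om0 C0 delta F u eta @[eta --> 0^'+] -->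
       relaxed Om0 C0 delta F u) /\
    relaxed Om0 C0 delta F u \is a fin_num.

End WaveCurves.

(* [lower_semicontinuous] of the library, on the subspace [A] of $L^1$. *)
Definition L1_lower_semicontinuous_on (R : realType) (n : nat)
    (A : set (R -> 'rV[R]_n)) (F : (R -> 'rV[R]_n) -> \bar R) :=
  forall (u : R -> 'rV[R]_n) (a : R), A u -> (a%:E < F u)%E ->
    exists2 e : R, 0 < e &
      forall v, A v -> (L1dist v u < e%:E)%E -> (a%:E < F v)%E.

(* Main.v *)
(** The relaxation of any functional by infima over shrinking [L^1]-balls is
    lower semicontinuous: these infima increase as the radius shrinks, so the
    relaxed functional is their supremum, and a ball of radius [eta / 2] around
    [v] lies in the ball of radius [eta] around [u] as soon as the distance
    from [v] to [u] is less than [eta / 2]. The wave structure enters only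
    through the bounds [0 <= Q] and [0 <= V], which make the relaxed functionals
    finite; any positive constants [C0] and [delta_o] are therefore admissible. *)
Require Import Defs.
From mathcomp Require Import all_boot all_order all_algebra.
From mathcomp Require Import all_classical all_reals all_analysis.
From mathcomp Require Import measurable_realfun ring lra.
Import Order.TTheory GRing.Theory Num.Theory.
Import numFieldNormedType.Exports.
Local Open Scope classical_set_scope.
Local Open Scope ring_scope.

Lemma sum_sqr_ge0 (R : realType) (I : Type) (s : seq I) (a : I -> R) :
  0 <= \sum_(i <- s) a i ^+ 2.
Proof. by apply: sumr_ge0 => i _; rewrite sqr_ge0. Qed.

Lemma sum_sqrD (R : realType) (I : Type) (s : seq I) (a b : I -> R) (x y : R) :
  \sum_(i <- s) (x * a i + y * b i) ^+ 2 =
  x ^+ 2 * \sum_(i <- s) a i ^+ 2 + 2 * x * y * \sum_(i <- s) a i * b i +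
  y ^+ 2 * \sum_(i <- s) b i ^+ 2.
Proof. by rewrite !mulr_sumr -!big_split; apply: eq_bigr => i _ /=; ring. Qed.

(** Cauchy-Schwarz: the quadratic form [quad] in [x] and [y] is a sum of squares, and well-chosen
    arguments give [P ^+ 2 <= A * B]. *)
Lemma sum_mul_le_sqrt (R : realType) (I : Type) (s : seq I) (a b : I -> R) :
  \sum_(i <- s) a i * b i <=
  Num.sqrt (\sum_(i <- s) a i ^+ 2) * Num.sqrt (\sum_(i <- s) b i ^+ 2).
Proof.
set A := \sum_(i <- s) a i ^+ 2; set B := \sum_(i <- s) b i ^+ 2.
set P := \sum_(i <- s) a i * b i.
have A0 : 0 <= A by exact: sum_sqr_ge0.
have B0 : 0 <= B by exact: sum_sqr_ge0.
have quad x y : 0 <= x ^+ 2 * A + 2 * x * y * P + y ^+ 2 * B.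
  by rewrite -sum_sqrD; exact: sum_sqr_ge0.
suff P2 : P ^+ 2 <= A * B.
  rewrite -sqrtrM// (le_trans (ler_norm P))// -sqrtr_sqr ler_wsqrtr//.
have [B_eq0|B_neq0] := eqVneq B 0.
  (* With [B = 0] the form takes the value [- (A + 2) * P ^+ 2] here, which forces [P = 0]. *)
  have := quad P (- (A + 1)); rewrite B_eq0; have := sqr_ge0 P; nra.
(* At [(B, - P)] the form equals [B * (A * B - P ^+ 2)], and [B] is positive. *)
have : 0 <= B * (A * B - P ^+ 2) by have := quad B (- P); lra.
by rewrite pmulr_rge0 ?lt_neqAle 1?eq_sym ?B_neq0// subr_ge0.
Qed.

(** Minkowski's inequality: after squaring both sides, only the cross terms differ, and
    Cauchy-Schwarz compares them. *)
Lemma enormD (R : realType) (n : nat) (u v : 'rV[R]_n) :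
  enorm (u + v) <= enorm u + enorm v.
Proof.
rewrite /enorm -[leRHS]ger0_norm ?addr_ge0 ?sqrtr_ge0// -sqrtr_sqr ler_wsqrtr//.
(* The factors 1 bring the summand into the form expected by [sum_sqrD]. *)
under eq_bigr do rewrite mxE -[u _ _]mul1r -[v _ _]mul1r.
rewrite sum_sqrD sqrrD !sqr_sqrtr ?sum_sqr_ge0//.
have := @sum_mul_le_sqrt R _ (index_enum 'I_n) (u ord0) (v ord0); lra.
Qed.

Lemma enorm_ge0 (R : realType) (n : nat) (u : 'rV[R]_n) : 0 <= enorm u.
Proof. exact: sqrtr_ge0. Qed.

(** Supplies the measurability conditions for adding and comparing the integrals that define
    [L1dist]. *)
Lemma measurable_enormB (R : realType) (n : nat) (u v : R -> 'rV[R]_n) :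
  L1 u -> L1 v ->
  measurable_fun setT (EFin \o (fun x => enorm (u x - v x))).
Proof.
move=> Lu Lv; apply/measurable_EFinP.
apply: (@measurableT_comp _ _ _ _ _ _ (@Num.sqrt R)).
  by apply: continuous_measurable_fun; exact: sqrt_continuous.
apply: measurable_sum => i; apply: measurable_funX.
under eq_fun do rewrite !mxE.
by apply: measurable_funB; apply/measurable_EFinP;
  [case/integrableP: (Lu i)|case/integrableP: (Lv i)].
Qed.

Lemma L1dist_triangle (R : realType) (n : nat) (u v z : R -> 'rV[R]_n) :
  L1 u -> L1 v -> L1 z -> (L1dist u z <= L1dist u v + L1dist v z)%E.
Proof.
move=> Lu Lv Lz; rewrite /L1dist -ge0_integralD//=; last 4 first.
- by move=> x _; rewrite lee_fin enorm_ge0.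
- exact: measurable_enormB.
- by move=> x _; rewrite lee_fin enorm_ge0.
- exact: measurable_enormB.
apply: ge0_le_integral => //=.
- by move=> x _; rewrite lee_fin enorm_ge0.
- exact: measurable_enormB.
- by apply: emeasurable_funD; exact: measurable_enormB.
move=> x _; rewrite -EFinD lee_fin.
have -> : u x - z x = (u x - v x) + (v x - z x) by rewrite addrA subrK.
exact: enormD.
Qed.

Section Relaxation.
Variables (R : realType) (n : nat) (Om Om0 : set 'rV[R]_n) (w : wave_param R n).
Variables (C0 delta : R) (F : (R -> 'rV[R]_n) -> R).
Local Notation D := (D Om w Om0 C0 delta).
Local Notation B := (B Om w Om0 C0 delta).
Local Notation inf_near := (inf_near Om w Om0 C0 delta F).
Local Notation relaxed := (relaxed Om w Om0 C0 delta F).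

Lemma inf_near_nonincreasing (u : R -> 'rV[R]_n) :
  {homo inf_near u : x y / x <= y >-> (y <= x)%E}.
Proof.
move=> x y xy; apply: ereal_inf_le_tmp => _ [v [Dv vu] <-]; exists v => //.
by split => //; rewrite (lt_le_trans vu)// lee_fin.
Qed.

Lemma inf_near_cvg (u : R -> 'rV[R]_n) :
  inf_near u eta @[eta --> 0^'+] -->
  ereal_sup [set inf_near u eta | eta in `]0, +oo[%classic].
Proof.
apply: nonincreasing_at_right_cvge => // x y _ _.
exact: inf_near_nonincreasing.
Qed.

Lemma relaxedE (u : R -> 'rV[R]_n) :
  relaxed u = ereal_sup [set inf_near u eta | eta in `]0, +oo[%classic].
Proof. by apply: cvg_lim; [|exact: inf_near_cvg]. Qed.

Lemma inf_near_le_relaxed (u : R -> 'rV[R]_n) (eta : R) :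
  0 < eta -> (inf_near u eta <= relaxed u)%E.
Proof.
by move=> eta0; rewrite relaxedE; apply: ereal_sup_ubound; exists eta;
  rewrite //= in_itv/= andbT.
Qed.

(** The bound [m] passes to every infimum, even over an empty ball. The bound [M] passes because [u]
    is a limit of elements of [Dstar], so that no ball around it is empty. *)
Lemma relaxed_well_defined (m M : R) :
  (forall v, Dstar Om w Om0 C0 delta v -> m <= F v <= M) ->
  well_defined Om w Om0 C0 delta F.
Proof.
move=> Fb u [Lu uD]; split; first by rewrite relaxedE; exact: inf_near_cvg.
have le_mr : (m%:E <= relaxed u)%E.
  apply: le_trans (inf_near_le_relaxed u _ ltr01).
  by apply: le_ereal_inf_tmp => _ [v [/Fb/andP[mF _] _] <-]; rewrite lee_fin.
have le_rM : (relaxed u <= M%:E)%E.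
  rewrite relaxedE; apply: ge_ereal_sup => _ [eta /= eta0 <-].
  move: eta0; rewrite in_itv/= andbT => /uD[v Dv vu].
  apply: (@le_trans _ _ (F v)%:E); first by apply: ereal_inf_lbound; exists v.
  by rewrite lee_fin; case/andP: (Fb v Dv).
by rewrite fin_numElt (lt_le_trans (ltNyr m))// (le_lt_trans le_rM)// ltry.
Qed.

Lemma relaxed_lsc : L1_lower_semicontinuous_on D relaxed.
Proof.
(* As [a] lies strictly below a supremum, a single radius [eta] already satisfies
   [a < inf_near u eta]. *)
move=> u a Du; rewrite relaxedE => /ereal_sup_gt[_ [eta /= + <-] aeta].
rewrite in_itv/= andbT => eta0; exists (eta / 2); first by rewrite divr_gt0.
move=> v Dv vu; apply: lt_le_trans aeta _.
apply: le_trans (inf_near_le_relaxed v (eta / 2) _); last by rewrite divr_gt0.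
apply: ereal_inf_le_tmp => _ [z [Dz zv] <-]; exists z => //; split => //.
have [Lz _ _ _] := Dz.
apply: le_lt_trans (L1dist_triangle _ _ _ _ _ Lz Dv.1 Du.1) _.
by rewrite [eta in (_ < eta%:E)%E]splitr EFinD lteD.
Qed.

End Relaxation.

(** A sum over a set with infinite support is 0 by convention, so the sign of the terms decides in
    every case. *)
Lemma Q_ge0 (R : realType) (n : nat) (Om : set 'rV[R]_n) (w : wave_param R n)
  (u : R -> 'rV[R]_n) : 0 <= Q Om w u.
Proof. by apply: fsumr_ge0 => p _; rewrite normr_ge0. Qed.

Lemma V_ge0 (R : realType) (n : nat) (w : wave_param R n)
  (u : R -> 'rV[R]_n) : 0 <= V w u.
Proof. by apply: fsumr_ge0 => x _; apply: sumr_ge0 => i _. Qed.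

Theorem proposition3p1 (R : realType) (n : nat)
    (f : 'rV[R]_n -> 'rV[R]_n) (Om Om0 : set 'rV[R]_n) (w : wave_param R n) :
  (0 < n)%N ->
  open Om -> Om 0 -> Ck_on 4 Om f ->
  strictly_hyperbolic f Om ->
  (forall j, genuinely_nonlinear Om w j \/ linearly_degenerate Om w j) ->
  wave_curves f Om w ->
  open Om0 -> Om0 0 -> Om0 `<=` base w -> E_defined_on w Om0 ->
  exists C0 delta_o : R, [/\ 0 < C0, 0 < delta_o &
    forall delta : R, 0 < delta < delta_o ->
      [/\ well_defined Om w Om0 C0 delta (Q Om w),
          well_defined Om w Om0 C0 delta (Upsilon Om w C0),
          L1_lower_semicontinuous_on (D Om w Om0 C0 delta)
            (Qbar Om w Om0 C0 delta) &
          L1_lower_semicontinuous_on (D Om w Om0 C0 delta)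
            (Upsilonbar Om w Om0 C0 delta)]].
Proof.
move=> _ _ _ _ _ _ _ _ _ _ _; exists 1, 1; split => // delta _.
(* Membership in [Dstar] gives [V + Q < delta]; since both terms are nonnegative, [delta] bounds [Q]
   as well as [Upsilon]. *)
have bounds v : Dstar Om w Om0 1 delta v ->
    0 <= Q Om w v <= delta /\ 0 <= Upsilon Om w 1 v <= delta.
  rewrite /Dstar/= => -[_ _ _]; rewrite /Upsilon.
  by have := Q_ge0 _ _ Om w v; have := V_ge0 _ _ w v; split; lra.
split; try exact: relaxed_lsc.
- by apply: (@relaxed_well_defined _ _ _ _ _ _ _ _ 0 delta) => v /bounds[].
- by apply: (@relaxed_well_defined _ _ _ _ _ _ _ _ 0 delta) => v /bounds[].
Qed.
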